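(* Consider the bi-objective problem $\min_{x\in S}f(x)$ and a tolerance vector $\delta=(\delta_1,\delta_2)$ with $\delta_1,\delta_2>0$, and assume that the Pareto Front is a continuous and compact curve in $\mathbb R^2$. Let $\mathcal D$ be a data-set of Pareto Front samples. If the central Pareto Front estimate $\hat{\mathcal P}_c=W^{-1}\hat h_c$, $\hat h_c=\frac12(\bar h_{\mathcal D}+\underline h_{\mathcal D})$, is adopted, then the following are equivalent: (i) for every $\mathcal P\in FPFS_{\mathcal D}$ there is a realization $\mathcal R:\hat{\mathcal P}_c\to\mathcal P$ such that for every $\hat z\in\hat{\mathcal P}_c$, with $z^*=\mathcal R(\hat z)$ and $\varepsilon=\hat z-z^*$, one has $|\varepsilon_1|<\delta_1$ and $|\varepsilon_2|<\delta_2$; (ii) $\overline\lambda_{\mathcal D}\le2\sqrt2$. Moreover, the corresponding minimum number of samples is $$\underline M_c=\left\lceil\frac14\left(\frac{\Delta_1}{\delta_1}+\frac{\Delta_2}{\delta_2}\right)\right\rceil+1,$$ and the corresponding data-set $\mathcal D$ shall be evenly allocated in the segment $[z_v^{*(a1)},z_v^{*(a2)}]$.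
   Context: Setting. $f=(f_1,f_2):\mathbb R^n\to\mathbb R^2$, $S\subset\mathbb R^n$, $Z=\{f(x):x\in S\}$. Let $\mathbb R^2_{\succ0}$ (resp. $\mathbb R^2_{\prec0}$) be the set of nonzero vectors with non-negative (resp. non-positive) entries, and let $\oplus$ be the Minkowski sum. A point $z^{(1)}\in Z$ dominates $z^{(2)}\in Z$ iff $z^{(2)}\in\{z^{(1)}\}\oplus\mathbb R^2_{\succ0}$. The Pareto Front (PF) of the problem is the set of all non-dominated points of $Z$. The anchor points $z^{*(a1)},z^{*(a2)}$ are the PF points minimizing $f_1$, resp. $f_2$, over $S$, and $\Delta_1=z_1^{*(a2)}-z_1^{*(a1)}$, $\Delta_2=z_2^{*(a1)}-z_2^{*(a2)}$. Data. A data-set $\mathcal D=\{z^{*(a1)},z^{*(1)},\dots,z^{*(M-2)},z^{*(a2)}\}$ is a finite set of $M\ge2$ PF points (samples), including the two anchor points, listed in strictly increasing order of the first coordinate. The anchor points are counted in the number of samples. Transformation. $$W=\frac{\sqrt2}{2}\begin{bmatrix}1&-1\\1&1\end{bmatrix}\begin{bmatrix}1/\delta_1&0\\0&1/\delta_2\end{bmatrix}.$$ For $z\in\mathbb R^2$ write $[z_v,z_q]^T=Wz$. The samples are also strictly ordered by increasing $v$-coordinate. For a function $h:[z_v^{*(a1)},z_v^{*(a2)}]\to\mathbb R$ write $W^{-1}h=\{W^{-1}[v,h(v)]^T: v\in[z_v^{*(a1)},z_v^{*(a2)}]\}$. Under the assumption on the PF, the PF equals $W^{-1}h$ for a continuous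 function $h$. Feasible set and bounds. For each $z^{*(j)}\in\mathcal D$ that is not an anchor point let $I^{(j)}=(\{z^{*(j)}\}\oplus\mathbb R^2_{\succ0})\cup(\{z^{*(j)}\}\oplus\mathbb R^2_{\prec0})$. For the anchor points, $I^{(a1)}$ is given by the same formula (with $z^{*(a1)}$) united with $\{z:z_1<z_1^{*(a1)}\}$, and $I^{(a2)}$ by the same formula (with $z^{*(a2)}$) united with $\{z:z_2<z_2^{*(a2)}\}$. Let $\mathcal I_{\mathcal D}$ be the union of these sets over all points of $\mathcal D$, and $\mathcal A_{\mathcal D}=\mathbb R^2\setminus\mathcal I_{\mathcal D}$. The Feasible Pareto Function Set $FPFS_{\mathcal D}$ is the set of continuous functions $h:[z_v^{*(a1)},z_v^{*(a2)}]\to\mathbb R$ with $W^{-1}h\subset\mathcal A_{\mathcal D}$. By abuse of notation, for a curve $\mathcal P=W^{-1}h$, $\mathcal P\in FPFS_{\mathcal D}$ means $h\in FPFS_{\mathcal D}$. Let $\bar h_{\mathcal D}(v)=\sup_{h\in FPFS_{\mathcal D}}h(v)$, $\underline h_{\mathcal D}(v)=\inf_{h\in FPFS_{\mathcal D}}h(v)$, and $\overline\lambda_{\mathcal D}=\max_{v\in[z_v^{*(a1)},z_v^{*(a2)}]}(\bar h_{\mathcal D}(v)-\underline h_{\mathcal D}(v))$. A realization is a map from the estimated front $\hat{\mathcal P}_c$ to the front $\mathcal P$. Meaning of the terms. The ''corresponding minimum number of samples'' is the minimum number of samples required to satisfy (ii). For the analogous result on arbitrary estimates, the source comments that this number can be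 evaluated after computing only the two anchor points and is the minimum that surely (i.e., no matter the shape of the actual PF) attains the condition. ''Evenly allocated'' refers to the $v$-coordinates of the samples: the samples, anchor points included, uniformly partition the segment $[z_v^{*(a1)},z_v^{*(a2)}]$.
   Formalization: With fixed anchors the minimum fails if some Δ_i≤2δ_i, so it is taken over all fronts on the same v-segment, and with fixed anchors only if Δ_i>2δ_i for v-placements chosen before the front is known; even allocation is shown to exist and suffice, not to be necessary. *)

(* Defs.v *)
From HB Require Import structures.
From mathcomp Require Import all_boot all_order all_algebra.
From mathcomp Require Import all_classical all_reals all_analysis.

Set Implicit Arguments.
Unset Strict Implicit.
Unset Printing Implicit Defensive.

Import Order.TTheory GRing.Theory Num.Theory.
Import numFieldNormedType.Exports.

Local Open Scope classical_set_scope.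
Local Open Scope ring_scope.

(* Library: MathComp-Analysis.  Points of the plane are column vectors
   z : 'cV[R]_2, with coordinates z 0 0 (the first) and z 1 0 (the second). *)

Section ParetoFront.
Context {R : realType}.
Implicit Types (z w a : 'cV[R]_2) (A B : set 'cV[R]_2).

Definition minkowski_sum A B : set 'cV[R]_2 := [set z + w | z in A & w in B].

Definition plane_pos : set 'cV[R]_2 :=
  [set z | z != 0 /\ forall i, 0 <= z i 0].

Definition plane_neg : set 'cV[R]_2 :=
  [set z | z != 0 /\ forall i, z i 0 <= 0].

Definition dominates z w := minkowski_sum [set z] plane_pos w.

Context {n : nat}.
Implicit Types (S : set 'cV[R]_n) (f : 'cV[R]_n -> 'cV[R]_2).

Definition pareto_front S f : set 'cV[R]_2 :=
  [set z | (f @` S) z /\ forall w, (f @` S) w -> ~ dominates w z].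

Definition is_anchor (i : 'I_2) S f a :=
  pareto_front S f a /\ forall x, S x -> a i 0 <= f x i 0.

(* D lists the samples by increasing first coordinate; as its two ends are
   distinct entries, it has at least two samples. *)
Definition is_dataset S f a1 a2 (D : seq 'cV[R]_2) :=
  [/\ is_anchor 0 S f a1, is_anchor 1 S f a2,
      exists s, D = a1 :: rcons s a2,
      sorted (fun z w => z 0 0 < w 0 0) D &
      forall z, z \in D -> pareto_front S f z].

End ParetoFront.

(* A continuous and compact curve: a continuous image of a segment. *)
Definition compact_curve {R : realType} (C : set 'cV[R]_2) :=
  exists2 g : R -> 'cV[R]_2,
    {within `[0, 1]%classic, continuous g} & C = g @` `[0, 1]%classic.

Section Bounds.
Context {R : realType}.
Variable delta : 'cV[R]_2.
Implicit Types (z w : 'cV[R]_2) (D : seq 'cV[R]_2) (h : R -> R) (v q : R).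

Definition Wmx : 'M[R]_2 :=
  (Num.sqrt 2 / 2) *:
    (\matrix_(i < 2, j < 2) (if (i == 0) && (j == 1) then -1 else 1)
     *m diag_mx (\row_(j < 2) (delta j 0)^-1)).

Definition vcoord z : R := (Wmx *m z) 0 0.

Definition vq_point v q : 'cV[R]_2 :=
  invmx Wmx *m (\col_(i < 2) (if i == 0 then v else q)).

(* By construction of the data-sets, the ends of the list are the anchors. *)
Definition anchor1 D : 'cV[R]_2 := head 0 D.
Definition anchor2 D : 'cV[R]_2 := last 0 D.

Definition vsegment D : set R :=
  `[vcoord (anchor1 D), vcoord (anchor2 D)]%classic.

(* W^-1 h; only the values of h on the segment matter. *)
Definition curve D h : set 'cV[R]_2 :=
  [set vq_point v (h v) | v in vsegment D].

Definition infeasible_of D w : set 'cV[R]_2 :=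
  minkowski_sum [set w] plane_pos `|` minkowski_sum [set w] plane_neg
  `|` [set z : 'cV[R]_2 | w = anchor1 D /\ z 0 0 < w 0 0]
  `|` [set z : 'cV[R]_2 | w = anchor2 D /\ z 1 0 < w 1 0].

Definition infeasible D : set 'cV[R]_2 :=
  \bigcup_(w in [set` D]) infeasible_of D w.

Definition feasible D : set 'cV[R]_2 := ~` infeasible D.

Definition FPFS D : set (R -> R) :=
  [set h | {within vsegment D, continuous h} /\ curve D h `<=` feasible D].

Definition h_upper D v : R := sup [set h v | h in FPFS D].
Definition h_lower D v : R := inf [set h v | h in FPFS D].
Definition h_gap D v : R := h_upper D v - h_lower D v.

Definition lambda_max D : R := sup [set h_gap D v | v in vsegment D].

Definition h_central D v : R := 2^-1 * (h_upper D v + h_lower D v).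

Definition realizable_within_tolerance (Phat P : set 'cV[R]_2) :=
  exists2 r : 'cV[R]_2 -> 'cV[R]_2, set_fun Phat P r &
    forall z, Phat z ->
      `|(z - r z) 0 0| < delta 0 0 /\ `|(z - r z) 1 0| < delta 1 0.

Definition evenly_allocated D :=
  forall j, (j < size D)%N ->
    vcoord (nth 0 D j) = vcoord (anchor1 D)
      + j%:R / (size D).-1%:R * (vcoord (anchor2 D) - vcoord (anchor1 D)).

Definition min_samples (a1 a2 : 'cV[R]_2) : nat :=
  (absz (Num.ceil (4^-1 * ((a2 0 0 - a1 0 0) / delta 0 0
                           + (a1 1 0 - a2 1 0) / delta 1 0)))).+1.

(* M samples are enough to get lambda_max <= 2 * sqrt 2 no matter the shape of
   the front (a continuous compact curve) over the v-segment [v1, v2]. *)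
Definition surely_attained (n : nat) (v1 v2 : R) (M : nat) :=
  forall (S : set 'cV[R]_n) (f : 'cV[R]_n -> 'cV[R]_2) (a1 a2 : 'cV[R]_2),
    compact_curve (pareto_front S f) ->
    is_anchor 0 S f a1 -> is_anchor 1 S f a2 ->
    vcoord a1 = v1 -> vcoord a2 = v2 ->
    exists D, [/\ is_dataset S f a1 a2 D, size D = M &
                  lambda_max D <= 2 * Num.sqrt 2].

End Bounds.

(* Main.v *)
Require Import Defs.
From HB Require Import structures.
From mathcomp Require Import all_boot all_order all_algebra.
From mathcomp Require Import all_classical all_reals all_analysis.
From mathcomp Require Import ring lra.

Set Implicit Arguments.
Unset Strict Implicit.
Unset Printing Implicit Defensive.

Import Order.TTheory GRing.Theory Num.Theory.
Import numFieldNormedType.Exports.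

Local Open Scope classical_set_scope.
Local Open Scope ring_scope.

(* In the rescaled and rotated coordinates (v, q), z dominates w iff w <> z and
   q w - q z >= |v w - v z|, so the points of a front are the points of a graph
   that is strictly nonexpansive, and a feasible curve is a continuous graph
   that stays outside the closed vertical cones over the samples.  The extremal
   functions are U v = min_z (q z + |v - v z|) and
   L v = max_z (q z - |v - v z|): they are 1-Lipschitz, and t U + (1 - t) L is
   feasible for all 0 < t < 1.

   An error is within the tolerance iff |dv| + |dq| < sqrt 2.  Projecting along
   v proves (ii) -> (i).  Conversely, where U - L is maximal, U being
   1-Lipschitz puts every point of the graph of U at distance at least
   lambda / 2 from the central point; take t U + (1 - t) L with t close to 1.

   Between consecutive samples the maximal gap is at most dv, and it is
   at least dv - |dq| by looking at the midpoint.  So steps dv <= 2 sqrt 2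
   suffice, and with fewer samples some step is wider than 2 sqrt 2, which is
   fatal when the front is flat, or flat enough, over that step. *)

(** Used with first summand v or -v and second summand q: the original coordinates are positive
    multiples of q + v and q - v, so for |dq| < |dv| the variable v alone decides their order. *)
Lemma ltrD_dominated (R : realDomainType) (a b p q : R) :
  `|p - q| < `|a - b| -> (a + p < b + q) = (a < b).
Proof.
rewrite ltr_norml => /andP[]; case: (ltrgtP a b) => ab *.
- by apply/idP; lra.
- by apply/negP; lra.
- lra.
Qed.

(** * The coordinates (v, q) and dominance *)

Section Coordinates.
Context {R : realType}.
Variable delta : 'cV[R]_2.
Hypotheses (delta1_gt0 : 0 < delta 0 0) (delta2_gt0 : 0 < delta 1 0).
Implicit Types (z w : 'cV[R]_2) (v q : R).

Let c : R := Num.sqrt 2 / 2.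

Definition qcoord z : R := (Wmx delta *m z) 1 0.

Lemma half_sqrt2_gt0 : 0 < c.
Proof. by rewrite divr_gt0 ?sqrtr_gt0. Qed.

Lemma sqr_half_sqrt2 : c ^+ 2 = 2^-1.
Proof. rewrite expr_div_n sqr_sqrtr ?ler0n//; by field. Qed.

Lemma vcoordE z : vcoord delta z = c * (z 0 0 / delta 0 0 - z 1 0 / delta 1 0).
Proof.
rewrite /vcoord /Wmx -scalemxAl mxE -mulmxA mul_diag_mx mxE !big_ord_recl
  big_ord0.
rewrite !mxE /= -/c; congr (_ * _).
have -> : lift ord0 ord0 = 1 :> 'I_2 by apply: val_inj.
by rewrite ?mulN1r ?addr0 ?mul1r [_^-1 * _]mulrC [(delta 1 0)^-1 * _]mulrC.
Qed.

Lemma qcoordE z : qcoord z = c * (z 0 0 / delta 0 0 + z 1 0 / delta 1 0).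
Proof.
rewrite /qcoord /Wmx -scalemxAl mxE -mulmxA mul_diag_mx mxE !big_ord_recl
  big_ord0.
rewrite !mxE /= -/c; congr (_ * _).
have -> : lift ord0 ord0 = 1 :> 'I_2 by apply: val_inj.
by rewrite ?addr0 ?mul1r [_^-1 * _]mulrC [(delta 1 0)^-1 * _]mulrC.
Qed.

Lemma coord1E z : z 0 0 = delta 0 0 * (c * (vcoord delta z + qcoord z)).
Proof.
have c2 := sqr_half_sqrt2.
rewrite vcoordE qcoordE -mulrDr mulrA mulrA -mulrA mulrA -(mulrA (delta 0 0))
  -expr2 c2.
by field; rewrite !gt_eqF.
Qed.

Lemma coord2E z : z 1 0 = delta 1 0 * (c * (qcoord z - vcoord delta z)).
Proof.
have c2 := sqr_half_sqrt2.
rewrite vcoordE qcoordE -mulrBr mulrA mulrA -mulrA mulrA -(mulrA (delta 1 0))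
  -expr2 c2.
by field; rewrite !gt_eqF.
Qed.

(** Up to nonzero factors the columns of W are (1, 1) and (-1, 1), so a row u with u W = 0 has u_0 +
    u_1 = 0 and u_1 - u_0 = 0. *)
Lemma Wmx_unit : Wmx delta \in unitmx.
Proof.
rewrite unitmxE unitfE; apply/det0P => -[u u_neq0 uW].
have e i : (u *m Wmx delta) 0 i = 0 by rewrite uW mxE.
have := e 1; have := e 0.
rewrite /Wmx -scalemxAr mulmxA mul_mx_diag !mxE !big_ord_recl !big_ord0 !mxE /=.
have -> : lift ord0 ord0 = 1 :> 'I_2 by apply: val_inj.
have c0 : c != 0 by rewrite gt_eqF// half_sqrt2_gt0.
have d0 : (delta 0 0)^-1 != 0 by rewrite invr_neq0// gt_eqF.
have d1 : (delta 1 0)^-1 != 0 by rewrite invr_neq0// gt_eqF.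
rewrite -/c !mulr1 !addr0 mulrN1.
move=> /eqP; rewrite mulf_eq0 (negPf c0) mulf_eq0 (negPf d0) /= orbF => /eqP u0.
move=> /eqP; rewrite mulf_eq0 (negPf c0) mulf_eq0 (negPf d1) /= orbF => /eqP u1.
move/eqP: u_neq0; apply; apply/rowP => i; rewrite mxE.
have [->|->] : i = 0 \/ i = 1.
- by case: i => -[|[|//]] ?; [left|right]; apply: val_inj.
- have : u 0 ord0 = 0 by lra.
  by [].
- by lra.
Qed.

Lemma vcoord_point v q : vcoord delta (vq_point delta v q) = v.
Proof. by rewrite /vcoord /vq_point mulKVmx ?Wmx_unit// mxE. Qed.

Lemma qcoord_point v q : qcoord (vq_point delta v q) = q.
Proof. by rewrite /qcoord /vq_point mulKVmx ?Wmx_unit// mxE. Qed.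

Lemma eq_vq z w : vcoord delta z = vcoord delta w -> qcoord z = qcoord w ->
  z = w.
Proof.
move=> ev eq; apply: (can_inj (mulKmx Wmx_unit)); apply/colP => i.
have [->|->] : i = 0 \/ i = 1; [|exact: ev|exact: eq].
by case: i => -[|[|//]] ?; [left|right]; apply: val_inj.
Qed.

Lemma vq_point_coord z : vq_point delta (vcoord delta z) (qcoord z) = z.
Proof. by apply: eq_vq; rewrite ?vcoord_point ?qcoord_point. Qed.

Lemma vcoordB z w : vcoord delta (z - w) = vcoord delta z - vcoord delta w.
Proof. by rewrite /vcoord mulmxBr !mxE. Qed.

Lemma qcoordB z w : qcoord (z - w) = qcoord z - qcoord w.
Proof. by rewrite /qcoord mulmxBr !mxE. Qed.

(** The entries of z are positive multiples of q + v and q - v, so W maps the closed quadrant to the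
    closed cone around the q-axis. *)
Lemma coords_ge0 z :
  (forall i, 0 <= z i 0) <-> `|vcoord delta z| <= qcoord z.
Proof.
rewrite ler_norml.
have h1 : (0 <= z 0 0) = (0 <= vcoord delta z + qcoord z).
  by rewrite coord1E pmulr_rge0// pmulr_rge0// half_sqrt2_gt0.
have h2 : (0 <= z 1 0) = (vcoord delta z <= qcoord z).
  by rewrite coord2E pmulr_rge0// pmulr_rge0 ?subr_ge0// half_sqrt2_gt0.
split=> [h|/andP[k1 k2] i].
  by rewrite -h2 h andbT lerNl -subr_ge0 opprK addrC -h1 h.
have [->|->] : i = 0 \/ i = 1; [|by rewrite h1; lra|by rewrite h2].
by case: i => -[|[|//]] ?; [left|right]; apply: val_inj.
Qed.

(* The comparison [z != 0] in [plane_pos] is one of entry functions. *)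
Lemma fun_of_mx_neq0 z : (fun_of_matrix z != 0) <-> z != 0.
Proof.
split; move=> z0; apply/eqP => e; move/eqP: z0; apply.
  by rewrite e; apply/funext => i; apply/funext => j; rewrite mxE.
by apply/matrixP => i j; rewrite e mxE.
Qed.

Lemma dominatesE z w : dominates z w <->
  z != w /\ `|vcoord delta w - vcoord delta z| <= qcoord w - qcoord z.
Proof.
rewrite -vcoordB -qcoordB -coords_ge0; split.
  move=> [_ -> [u [/fun_of_mx_neq0 u0 u_ge0] <-]].
  rewrite addrAC subrr add0r; split=> //.
  by apply: contra_neq u0 => /(canLR (addKr _)) <-; rewrite addNr.
move=> [zw h]; exists z => //; exists (w - z); last by rewrite addrC subrK.
by split=> //; apply/fun_of_mx_neq0; rewrite subr_eq0 eq_sym.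
Qed.

Lemma minkowski_negE z w :
  minkowski_sum [set z] plane_neg w <-> dominates w z.
Proof.
split=> -[_ -> [u [/fun_of_mx_neq0 u0 u_sgn] <-]].
  exists (z + u) => //; exists (- u); last by rewrite addrK.
  split=> [|i]; last by rewrite mxE oppr_ge0.
  by apply/fun_of_mx_neq0; rewrite oppr_eq0.
exists (w + u) => //; exists (- u); last by rewrite addrK.
split=> [|i]; last by rewrite mxE oppr_le0.
by apply/fun_of_mx_neq0; rewrite oppr_eq0.
Qed.

(** A chord of slope less than 1 in the (v, q)-plane. For distinct points this is mutual
    non-dominance; for z = w it is false, so it also records distinctness. *)
Definition incomparable z w :=
  `|qcoord z - qcoord w| < `|vcoord delta z - vcoord delta w|.

Lemma incomparableP z w : z != w ->
  incomparable z w <-> ~ dominates z w /\ ~ dominates w z.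
Proof.
move=> zw; rewrite !dominatesE zw eq_sym zw /incomparable.
set dq := qcoord z - _; set dv := vcoord _ z - _.
rewrite -(opprB (qcoord z)) (distrC (vcoord _ w)) -/dq -/dv.
split=> [|[h1 h2]]; last first.
  rewrite ltr_norml ltrNl; apply/andP; split; rewrite ltNge; apply/negP => ?;
  [by apply: h1|by apply: h2].
by rewrite ltr_norml => /andP[? ?]; split=> -[_]; apply/negP;
  rewrite -ltNge// ltrNl.
Qed.

Lemma incomparable_sym z w : incomparable z w -> incomparable w z.
Proof. by rewrite /incomparable distrC (distrC (vcoord _ w)). Qed.

Lemma incomparable_neq z w : incomparable z w -> z != w.
Proof. by apply: contraPneq => ->; rewrite /incomparable !subrr ltxx. Qed.

Lemma incomparable_lt1 z w : incomparable z w ->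
  (z 0 0 < w 0 0) = (vcoord delta z < vcoord delta w).
Proof.
rewrite /incomparable => zw; rewrite (coord1E z) (coord1E w) ltr_pM2l//
  ltr_pM2l ?half_sqrt2_gt0//.
exact: ltrD_dominated.
Qed.

Lemma incomparable_lt2 z w : incomparable z w ->
  (z 1 0 < w 1 0) = (vcoord delta w < vcoord delta z).
Proof.
rewrite /incomparable => zw; rewrite (coord2E z) (coord2E w) ltr_pM2l//
  ltr_pM2l ?half_sqrt2_gt0//.
rewrite -[RHS]ltrN2 ![_ - vcoord _ _]addrC; apply: ltrD_dominated.
by rewrite -opprD normrN.
Qed.

Lemma pareto_incomparable n (S : set 'cV[R]_n) f z w : z != w ->
  pareto_front S f z -> pareto_front S f w -> incomparable z w.
Proof.
move=> zw [fz hz] [fw hw]; rewrite (incomparableP zw).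
split; [exact: (hw z fz)|exact: (hz w fw)].
Qed.

End Coordinates.

Lemma nonexpansive_continuous (R : realType) (F : R -> R) :
  (forall v w, F v <= F w + `|v - w|) -> continuous F.
Proof.
move=> FL v; apply/cvgrPdist_lt => e e0; near=> w.
have vw : `|v - w| < e by near: w; apply: cvgr_dist_lt => //; exact: cvg_id.
apply: le_lt_trans vw; rewrite ler_norml; apply/andP; split.
  by have := FL w v; rewrite distrC; lra.
by have := FL v w; lra.
Unshelve. all: by end_near. Qed.

(** A limit as k tends to 0, with k restricted to ]0, 1[ because blends of the envelopes are
    feasible only for such weights. *)
Lemma ler_addMeps (R : realFieldType) (s u g : R) : 0 <= g ->
  (forall k, 0 < k < 1 -> u <= s + k * g) -> u <= s.
Proof.
move=> g0 h; rewrite leNgt; apply/negP => su.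
have d0 : 0 < u - s + g by lra.
(* This k makes [k * g] smaller than [u - s], and the summand [u - s] in the denominator covers the
   case [g = 0]. *)
have /h : 0 < (u - s) / (2 * (u - s + g)) < 1.
  by rewrite divr_gt0 ?ltr_pdivrMr /=; lra.
apply/negP; rewrite -ltNge -ltrBrDl mulrAC ltr_pdivrMr; last lra.
nra.
Qed.

(** * The extremal feasible functions *)

Section Envelopes.
Context {R : realType}.
Variable delta : 'cV[R]_2.
Hypotheses (delta1_gt0 : 0 < delta 0 0) (delta2_gt0 : 0 < delta 1 0).
Variable D : seq 'cV[R]_2.
Hypothesis D_incomparable :
  {in D &, forall z w, z != w -> incomparable delta z w}.
Hypothesis D_neq0 : D != [::].
Implicit Types (z : 'cV[R]_2) (v w q t : R) (h : R -> R).

Local Notation vc := (vcoord delta).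
Local Notation qc := (qcoord delta).

(** Together with [lower], the McShane-Whitney extremal 1-Lipschitz extensions of the sample values.
    The real line has no top element, so the minimum starts from the term of the head of [D], itself
    a sample when [D] is nonempty. *)
Definition upper v : R :=
  \big[Num.min/qc (head 0 D) + `|v - vc (head 0 D)|]_(z <- D)
    (qc z + `|v - vc z|).

Definition lower v : R :=
  \big[Num.max/qc (head 0 D) - `|v - vc (head 0 D)|]_(z <- D)
    (qc z - `|v - vc z|).

Lemma head_mem : head 0 D \in D.
Proof. by move: D_neq0; case: D => //= a s _; rewrite mem_head. Qed.

Lemma upper_le v z : z \in D -> upper v <= qc z + `|v - vc z|.
Proof. by move=> zD; apply: (@ge_bigmin_seq _ _ _ _ _ z xpredT). Qed.

Lemma lower_ge v z : z \in D -> qc z - `|v - vc z| <= lower v.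
Proof. by move=> zD; apply: (@le_bigmax_seq _ _ _ _ _ z xpredT). Qed.

Lemma upper_attained v : exists2 z, z \in D & upper v = qc z + `|v - vc z|.
Proof.
rewrite /upper big_seq; elim/big_ind: _ => [|x y hx hy|z zD].
- by exists (head 0 D) => //; exact: head_mem.
- by rewrite minEle; case: ifP.
- by exists z.
Qed.

Lemma lower_attained v : exists2 z, z \in D & lower v = qc z - `|v - vc z|.
Proof.
rewrite /lower big_seq; elim/big_ind: _ => [|x y hx hy|z zD].
- by exists (head 0 D) => //; exact: head_mem.
- by rewrite maxEle; case: ifP.
- by exists z.
Qed.

Lemma upper_nonexpansive v w : upper v <= upper w + `|v - w|.
Proof.
have [z zD ->] := upper_attained w; apply: le_trans (upper_le v zD) _.
by have := ler_distD w v (vc z); lra.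
Qed.

Lemma lower_nonexpansive v w : lower v <= lower w + `|v - w|.
Proof.
have [z zD ->] := lower_attained v; have := lower_ge w zD.
by have := ler_distD v w (vc z); rewrite (distrC w v); lra.
Qed.

Lemma sample_cone z (w : 'cV[R]_2) : z \in D -> w \in D ->
  `|qc z - qc w| <= `|vc z - vc w|.
Proof.
move=> zD wD; have [->|zw] := eqVneq z w; first by rewrite !subrr.
exact/ltW/D_incomparable.
Qed.

Lemma upper_sample z : z \in D -> upper (vc z) = qc z.
Proof.
move=> zD; apply/eqP; rewrite eq_le; apply/andP; split.
  by have := upper_le (vc z) zD; rewrite subrr normr0 addr0.
have [w wD ->] := upper_attained (vc z).
by have := sample_cone zD wD; rewrite ler_norml => /andP[]; lra.
Qed.

Lemma lower_sample z : z \in D -> lower (vc z) = qc z.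
Proof.
move=> zD; apply/eqP; rewrite eq_le; apply/andP; split; last first.
  by have := lower_ge (vc z) zD; rewrite subrr normr0 subr0.
have [w wD ->] := lower_attained (vc z).
by have := sample_cone zD wD; rewrite ler_norml => /andP[]; lra.
Qed.

(** If one sample z attains both envelopes, they differ by 2 |v - v z| > 0. If two samples do, the
    strict inequality between them and the triangle inequality conclude. *)
Lemma lower_lt_upper v : (forall z, z \in D -> vc z != v) -> lower v < upper v.
Proof.
move=> hv; have [z zD ->] := lower_attained v;
  have [w wD ->] := upper_attained v.
have vz : 0 < `|v - vc z| by rewrite normr_gt0 subr_eq0 eq_sym hv.
have vw : 0 < `|v - vc w| by rewrite normr_gt0 subr_eq0 eq_sym hv.
have [->|zw] := eqVneq z w; first lra.
have := D_incomparable zD wD zw;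
  rewrite /incomparable => /(le_lt_trans (ler_norm _)).
by have := ler_distD v (vc z) (vc w); rewrite (distrC (vc z) v); lra.
Qed.

Lemma lower_le_upper v : lower v <= upper v.
Proof.
have [/hasP[z zD /eqP <-]|/hasPn h] := boolP (has (fun z => vc z == v) D).
  by rewrite upper_sample// lower_sample.
exact/ltW/lower_lt_upper.
Qed.

(** The cones omit their apex, hence the exception for a curve point equal to z. At v = v z the
    strict inequality is impossible, so a feasible curve passes through each sample whose v lies in
    the segment. *)
Lemma FPFSP h : FPFS delta D h <->
  {within vsegment delta D, continuous h} /\
  forall v, vsegment delta D v -> forall z, z \in D ->
    z != vq_point delta v (h v) ->
    `|h v - qc z| < `|v - vc z|.
Proof.
split=> -[ch H]; split=> //; [move=> v vD z zD zv|move=> _ [v vD <-]].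
  have nI : feasible D (vq_point delta v (h v)) by apply: H; exists v.
  have := incomparableP delta1_gt0 delta2_gt0 zv.
  rewrite /incomparable vcoord_point// qcoord_point// => I.
  rewrite distrC (distrC v); apply/I; split=> d; apply: nI; exists z => //.
    by left; left; left.
  by left; left; right; apply/minkowski_negE.
move=> [z zD]; have [zv|zv] := eqVneq z (vq_point delta v (h v)).
  case=> [[[|/minkowski_negE]|[_]]|[_]];
    rewrite -zv ?ltxx// => /(dominatesE delta1_gt0 delta2_gt0)[];
  by rewrite eqxx.
have := H v vD z zD zv; rewrite distrC (distrC v) => I.
have J : incomparable delta z (vq_point delta v (h v)).
  by rewrite /incomparable vcoord_point// qcoord_point.
have [J1 J2] := (incomparableP delta1_gt0 delta2_gt0 zv).1 J.
have J' := incomparable_sym J.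
move: vD; rewrite /vsegment /= in_itv /= => /andP[v1 v2].
(* The cone cases contradict [J1] and [J2]. In a half-plane beyond an anchor, incomparability with
   that anchor would put v outside the segment. *)
case=> [[[|/minkowski_negE]|[e]]|[e]] //.
  by rewrite (incomparable_lt1 delta1_gt0 delta2_gt0 J') vcoord_point// e
    ltNge v1.
by rewrite (incomparable_lt2 delta1_gt0 delta2_gt0 J') vcoord_point// e ltNge
  v2.
Qed.

Definition blend t v : R := t * upper v + (1 - t) * lower v.

Lemma blend_sample t z : z \in D -> blend t (vc z) = qc z.
Proof. by move=> zD; rewrite /blend upper_sample// lower_sample//; ring. Qed.

Lemma nonexpansive_within (F : R -> R) (A : set R) :
  (forall v w, F v <= F w + `|v - w|) -> {within A, continuous F}.
Proof. by move=> FL; apply/continuous_subspaceT/nonexpansive_continuous. Qed.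

Lemma blend_nonexpansive t : 0 <= t <= 1 ->
  forall v w, blend t v <= blend t w + `|v - w|.
Proof.
move=> /andP[t0 t1] v w; rewrite /blend.
have := upper_nonexpansive v w; have := lower_nonexpansive v w.
nra.
Qed.

(** At the v-coordinate of a sample the blend is that sample, incomparable with the others.
    Elsewhere it lies strictly between the envelopes, hence off every closed cone; the weights 0 and
    1 would touch the cones. *)
Lemma blend_FPFS t : 0 < t < 1 -> FPFS delta D (blend t).
Proof.
move=> /andP[t0 t1]; apply/FPFSP; split.
  by apply/nonexpansive_within/blend_nonexpansive; rewrite !ltW.
move=> v _ z zD zv.
have [/hasP[w wD /eqP vw]|/hasPn hv] := boolP (has (fun z => vc z == v) D).
  rewrite -vw blend_sample//.
  have zw : w != z.
    apply: contra_neq zv => <-.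
    by rewrite -vw blend_sample// vq_point_coord.
  exact: (D_incomparable wD zD zw).
have := lower_lt_upper hv; have := upper_le v zD; have := lower_ge v zD.
by rewrite /blend ltr_norml => *; apply/andP; split; nra.
Qed.

Lemma FPFS_bounds h v : FPFS delta D h -> vsegment delta D v ->
  lower v <= h v <= upper v.
Proof.
move=> /FPFSP[_ H] vD.
have H' z : z \in D -> `|h v - qc z| <= `|v - vc z|.
  move=> zD; have [->|/H hz] := eqVneq z (vq_point delta v (h v)).
    by rewrite vcoord_point// qcoord_point// !subrr.
  exact/ltW/hz.
have [z zD ->] := upper_attained v; have [w wD ->] := lower_attained v.
have := H' z zD; have := H' w wD.
by rewrite !ler_norml => /andP[? ?] /andP[? ?]; apply/andP; split; lra.
Qed.

(** The envelope itself need not be feasible, so the supremum is approached by blends whose weight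
    [1 - k] tends to 1. *)
Lemma h_upperE v : vsegment delta D v -> h_upper delta D v = upper v.
Proof.
move=> vD; rewrite /h_upper; set A := [set _ | _ in _].
have ub : ubound A (upper v).
  by move=> _ [h /FPFS_bounds hv <-]; have /andP[] := hv v vD.
have A_blend t : 0 < t < 1 -> A (blend t v) by move=> /blend_FPFS;
  exists (blend t).
apply/eqP; rewrite eq_le; apply/andP; split.
  by apply: ge_sup ub; exists (blend 2^-1 v); apply: A_blend; lra.
apply: (@ler_addMeps _ _ _ (upper v - lower v)).
  by rewrite subr_ge0 lower_le_upper.
move=> k k01; have : blend (1 - k) v <= sup A.
  by apply: ub_le_sup; [exists (upper v)|apply: A_blend; lra].
by rewrite /blend; lra.
Qed.

Lemma h_lowerE v : vsegment delta D v -> h_lower delta D v = lower v.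
Proof.
move=> vD; rewrite /h_lower; set A := [set _ | _ in _].
have lb : lbound A (lower v).
  by move=> _ [h /FPFS_bounds hv <-]; have /andP[] := hv v vD.
have A_blend t : 0 < t < 1 -> A (blend t v) by move=> /blend_FPFS;
  exists (blend t).
apply/eqP; rewrite eq_le; apply/andP; split; last first.
  by apply: lb_le_inf lb; exists (blend 2^-1 v); apply: A_blend; lra.
apply: (@ler_addMeps _ _ _ (upper v - lower v)).
  by rewrite subr_ge0 lower_le_upper.
move=> k k01; have : inf A <= blend k v.
  by apply: ge_inf; [exists (lower v)|apply: A_blend; lra].
by rewrite /blend; lra.
Qed.

Lemma h_gapE v : vsegment delta D v -> h_gap delta D v = upper v - lower v.
Proof. by move=> vD; rewrite /h_gap h_upperE// h_lowerE. Qed.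

Lemma h_centralE v : vsegment delta D v -> h_central delta D v = blend 2^-1 v.
Proof. by move=> vD; rewrite /h_central h_upperE// h_lowerE// /blend;
  field. Qed.

Hypothesis D_segment : vc (anchor1 D) <= vc (anchor2 D).

Lemma gap_max : exists2 v, vsegment delta D v &
  forall w, vsegment delta D w -> h_gap delta D w <= h_gap delta D v.
Proof.
have : {within vsegment delta D, continuous (fun v => upper v - lower v)}.
  apply: continuous_subspaceT => v.
  by apply: cvgB; apply: nonexpansive_continuous;
    [exact: upper_nonexpansive|exact: lower_nonexpansive].
move=> /(EVT_max D_segment)[v vD hv]; exists v => // w wD.
by rewrite !h_gapE//; apply: hv.
Qed.

(** The envelopes are continuous, so the extreme value theorem turns the [sup] of the definition
    into a maximum. *)
Lemma lambda_max_attained :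
  exists2 v, vsegment delta D v & h_gap delta D v = lambda_max delta D.
Proof.
have [v vD hv] := gap_max; exists v => //; rewrite /lambda_max.
apply/esym/eqP; rewrite eq_le; apply/andP; split.
  by apply: ge_sup => [|_ [w wD <-]]; [exists (h_gap delta D v), v|exact: hv].
by apply: ub_le_sup; [exists (h_gap delta D v) => _ [w wD <-];
  exact: hv|exists v].
Qed.

Lemma lambda_max_ge v : vsegment delta D v ->
  upper v - lower v <= lambda_max delta D.
Proof.
move=> vD; rewrite -h_gapE//; have [w wD hw] := gap_max.
by apply: ub_le_sup; [exists (h_gap delta D w) => _ [u uD <-];
  exact: hw|exists v].
Qed.

End Envelopes.

(** * Tolerance and the maximal gap: (i) and (ii) *)

Section Realizability.
Context {R : realType}.
Variable delta : 'cV[R]_2.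
Hypotheses (delta1_gt0 : 0 < delta 0 0) (delta2_gt0 : 0 < delta 1 0).
Implicit Types (z w : 'cV[R]_2) (v q t : R) (h : R -> R).

Local Notation vc := (vcoord delta).
Local Notation qc := (qcoord delta).

(** The two conditions read |v + q| < sqrt 2 and |q - v| < sqrt 2, and the larger of these absolute
    values is |v| + |q|: the box becomes a diamond. *)
Lemma tolerance_box z :
  (`|z 0 0| < delta 0 0 /\ `|z 1 0| < delta 1 0) <->
  `|vc z| + `|qc z| < Num.sqrt 2.
Proof.
have e (d x : R) : 0 < d ->
    (`|d * (Num.sqrt 2 / 2 * x)| < d) = (`|x| < Num.sqrt 2).
  move=> d0; rewrite normrM gtr0_norm// gtr_pMr// normrM gtr0_norm
    ?half_sqrt2_gt0//.
  have s0 : 0 < Num.sqrt 2 :> R by rewrite sqrtr_gt0.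
  rewrite -ltr_pdivlMl ?half_sqrt2_gt0// mulr1.
  have -> : (Num.sqrt 2 / 2)^-1 = Num.sqrt 2 :> R; last by [].
  rewrite invf_div; apply: (mulIf (lt0r_neq0 s0)).
  by rewrite divfK ?gt_eqF// -expr2 sqr_sqrtr.
rewrite (coord1E delta1_gt0 delta2_gt0 z) (coord2E delta1_gt0 delta2_gt0 z)
  !e//.
move: (vc z) (qc z) (Num.sqrt 2) => a b s; split=> [[]|].
  by rewrite !ltr_norml => /andP[? ?] /andP[? ?]; case: (ger0P a) => ?;
    case: (ger0P b) => ?; lra.
have := ler_norm a; have := ler_norm b; have := ler_norm (- a);
  have := ler_norm (- b).
by rewrite !normrN => *; split; rewrite ltr_norml; apply/andP; split; lra.
Qed.

Variable D : seq 'cV[R]_2.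
Hypothesis D_incomparable :
  {in D &, forall z w, z != w -> incomparable delta z w}.
Hypothesis D_neq0 : D != [::].
Hypothesis D_segment : vc (anchor1 D) <= vc (anchor2 D).

Let FPFSP := FPFSP delta1_gt0 delta2_gt0 D.

(** The gap bound is weak but the error bound is strict: off the samples [h] lies strictly between
    the envelopes, hence at less than half the gap from their midpoint; at a sample the error is
    0. *)
Lemma central_error h v : FPFS delta D h -> vsegment delta D v ->
  upper delta D v - lower delta D v <= 2 * Num.sqrt 2 ->
  `|h_central delta D v - h v| < Num.sqrt 2.
Proof.
move=> hF vD gap; have /andP[hl hu] :=
  FPFS_bounds delta1_gt0 delta2_gt0 D_neq0 hF vD.
have s0 : 0 < Num.sqrt 2 :> R by rewrite sqrtr_gt0.
rewrite (h_centralE delta1_gt0 delta2_gt0 D_incomparable)// /blend.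
have [/hasP[z zD /eqP vz]|/hasPn hv] := boolP (has (fun z => vc z == v) D).
  move: hl hu gap; rewrite -vz upper_sample// lower_sample// => *.
  by rewrite ltr_norml; apply/andP; split; lra.
have [_ /(_ v vD) H] := (FPFSP h).1 hF.
have H' z : z \in D -> `|h v - qc z| < `|v - vc z|.
  move=> zD; apply: H => //; apply: contra (hv z zD) => /eqP ->.
  by rewrite vcoord_point.
have [z zD eU] := upper_attained delta D_neq0 v.
have [w wD eL] := lower_attained delta D_neq0 v.
have := H' z zD; have := H' w wD; move: gap; rewrite eU eL => gap.
by rewrite !ltr_norml => /andP[? ?] /andP[? ?]; apply/andP; split; lra.
Qed.

Lemma lambda_max_realizable : lambda_max delta D <= 2 * Num.sqrt 2 ->
  forall h, FPFS delta D h -> realizable_within_tolerance delta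
    (curve delta D (h_central delta D)) (curve delta D h).
Proof.
move=> lam h hF; exists (fun z => vq_point delta (vc z) (h (vc z))).
  by move=> _ [v vD <-]; rewrite vcoord_point//; exists v.
move=> _ [v vD <-]; rewrite vcoord_point//; apply/tolerance_box.
rewrite vcoordB qcoordB !vcoord_point// !qcoord_point// subrr normr0 add0r.
apply: central_error => //; apply: le_trans lam.
exact: lambda_max_ge.
Qed.

Lemma realizable_lambda_max :
  (forall h, FPFS delta D h -> realizable_within_tolerance delta
    (curve delta D (h_central delta D)) (curve delta D h)) ->
  lambda_max delta D <= 2 * Num.sqrt 2.
Proof.
move=> real; rewrite leNgt; apply/negP => lam.
have s0 : 0 < Num.sqrt 2 :> R by rewrite sqrtr_gt0.
have [v0 v0D] := lambda_max_attained delta1_gt0 delta2_gt0 D_incomparable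
  D_neq0 D_segment.
rewrite h_gapE// => gap0.
set s := Num.sqrt 2 in lam s0 *; set l := lambda_max delta D in lam gap0 *.
have l0 : 0 < l by lra.
(* Chosen so that [k * l] is the excess of half the gap over sqrt 2. The blend of weight [1 - k] is
   at most [k * l] below [upper], so at horizontal distance x from [v0] it is still at least sqrt 2
   - x above the central point. *)
pose k := (l / 2 - s) / l.
have kl : k * l = l / 2 - s by rewrite divfK ?gt_eqF.
have k01 : 0 < k < 1 by apply/andP; split;
  rewrite /k ?ltr_pdivrMr ?divr_gt0//; lra.
have t01 : 0 < 1 - k < 1 by lra.
have [r rP rbox] := real _ (blend_FPFS delta1_gt0 delta2_gt0 D_incomparable
  D_neq0 t01).
pose z := vq_point delta v0 (h_central delta D v0).
have zC : curve delta D (h_central delta D) z by exists v0.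
have [v vD rz] := rP z zC; have /tolerance_box := rbox z zC.
rewrite -rz /z vcoordB qcoordB !vcoord_point// !qcoord_point//.
rewrite (h_centralE delta1_gt0 delta2_gt0 D_incomparable)//.
apply/negP; rewrite -leNgt -/s.
have := lambda_max_ge delta1_gt0 delta2_gt0 D_incomparable D_neq0 D_segment vD.
have := lower_le_upper D_incomparable D_neq0 v.
have := upper_nonexpansive delta D_neq0 v0 v.
rewrite -/l /blend distrC (distrC _ (_ + _)).
have := ler_norm ((1 - k) * upper delta D v + (1 - (1 - k)) * lower delta D v
  - (2^-1 * upper delta D v0 + (1 - 2^-1) * lower delta D v0)).
rewrite (distrC v v0); move: (`|_ - _|) `|v0 - v| => x y.
move: (upper _ _ _) (lower _ _ _) (upper _ _ _) (lower _ _ _) gap0 => u0 m0 u m.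
nra.
Qed.

End Realizability.

(** * Consecutive samples and the maximal gap *)

Lemma bracket (R : realDomainType) (x0 : R) (t : seq R) (v : R) :
  (1 < size t)%N -> head x0 t <= v <= last x0 t ->
  exists2 j, (j.+1 < size t)%N & nth x0 t j <= v <= nth x0 t j.+1.
Proof.
case: t => // a t; elim: t a => // b t IH a _ /= /andP[av vl].
have [vb|/ltW bv] := leP v b; first by exists 0%N; rewrite //= av.
case: t => [|c t] in IH vl *.
  by exists 0%N => //=; rewrite av.
have [|j jt hj] := IH b isT; first by rewrite /= bv.
by exists j.+1.
Qed.

(** Pigeonhole: the [(size t).-1] steps telescope to the difference of the ends, so they cannot all
    be at most [c]. *)
Lemma wide_step (R : realDomainType) (x0 c : R) (t : seq R) :
  (1 < size t)%N -> (size t).-1%:R * c < last x0 t - head x0 t ->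
  exists2 j, (j.+1 < size t)%N & c < nth x0 t j.+1 - nth x0 t j.
Proof.
case: t => // a t; elim: t a => // b [|d t] IH a _ /= h.
  by exists 0%N => //=; rewrite mul1r in h.
have [ab|ab] := ltP c (b - a); first by exists 0%N.
have [||j jt hj] := IH b; [by []| |by exists j.+1].
by move: h; rewrite /= -[(size t).+2]addn1 natrD mulrDl mul1r; lra.
Qed.

Section Gaps.
Context {R : realType}.
Variable delta : 'cV[R]_2.
Hypotheses (delta1_gt0 : 0 < delta 0 0) (delta2_gt0 : 0 < delta 1 0).
Variable D : seq 'cV[R]_2.
Implicit Types (z w : 'cV[R]_2) (v q t : R) (h : R -> R).

Local Notation vc := (vcoord delta).
Local Notation qc := (qcoord delta).

Hypothesis D_incomparable :
  {in D &, forall z w, z != w -> incomparable delta z w}.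
Hypothesis D_sorted : sorted (fun z w => vc z < vc w) D.
Hypothesis D_size : (1 < size D)%N.

Lemma dataset_neq0 : D != [::].
Proof. by case: D D_size. Qed.

Lemma vcoord_nth i j : (i < j)%N -> (j < size D)%N ->
  vc (nth 0 D i) < vc (nth 0 D j).
Proof.
move=> ij jD; have tr : transitive (fun z w => vc z < vc w).
  by move=> ? ? ?; exact: lt_trans.
by apply: (sorted_ltn_nth tr) => //; rewrite inE// (ltn_trans ij).
Qed.

Lemma vcoord_nth_le i j : (i <= j)%N -> (j < size D)%N ->
  vc (nth 0 D i) <= vc (nth 0 D j).
Proof.
by rewrite leq_eqVlt => /predU1P[->//|ij] jD; apply/ltW/vcoord_nth.
Qed.

Lemma anchor1_nth : anchor1 D = nth 0 D 0.
Proof. by rewrite nth0. Qed.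

Lemma anchor2_nth : anchor2 D = nth 0 D (size D).-1.
Proof. by rewrite nth_last. Qed.

Lemma vsegment_nth j : (j < size D)%N -> vsegment delta D (vc (nth 0 D j)).
Proof.
move=> jD; rewrite /vsegment /= in_itv /= anchor1_nth anchor2_nth.
have D0 := ltnW D_size.
by rewrite !vcoord_nth_le// ?ltn_predL// -ltnS prednK.
Qed.

Lemma anchors_lt : vc (anchor1 D) < vc (anchor2 D).
Proof.
rewrite anchor1_nth anchor2_nth vcoord_nth//;
  first by case: D D_size => // ? [].
by rewrite ltn_predL ltnW.
Qed.

(** Between two consecutive samples, the cones over the nearer one bound the gap by twice its
    distance to v, which is at most the step. *)
Lemma lambda_max_le d :
  (forall j, (j.+1 < size D)%N -> vc (nth 0 D j.+1) - vc (nth 0 D j) <= d) ->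
  lambda_max delta D <= d.
Proof.
move=> hd; have [v vD <-] := lambda_max_attained delta1_gt0 delta2_gt0
  D_incomparable dataset_neq0 (ltW anchors_lt).
rewrite (h_gapE delta1_gt0 delta2_gt0 D_incomparable dataset_neq0)//.
have [||j] := @bracket _ (vc 0) (map vc D) v; rewrite ?size_map//.
  move: vD; rewrite /vsegment /= in_itv /=.
  by rewrite -nth0 -nth_last size_map !(nth_map 0) ?nth0 ?nth_last//
    ?ltn_predL ltnW.
move=> jD; rewrite !(nth_map 0)//; last exact: ltnW.
move=> /andP[v1 v2]; have := hd j jD.
have jD' := ltnW jD; have zD := mem_nth 0 jD; have wD := mem_nth 0 jD'.
have := upper_le delta v zD; have := lower_ge delta v zD.
have := upper_le delta v wD; have := lower_ge delta v wD.
rewrite ger0_norm ?subr_ge0// ler0_norm ?subr_le0//.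
have [|] := leP (v - vc (nth 0 D j)) (vc (nth 0 D j.+1) - v); lra.
Qed.

Lemma lambda_max_ge_gap j : (j.+1 < size D)%N ->
  vc (nth 0 D j.+1) - vc (nth 0 D j)
    - `|qc (nth 0 D j.+1) - qc (nth 0 D j)| <= lambda_max delta D.
Proof.
move=> jD; have jD' := ltnW jD.
set w := nth 0 D j; set w' := nth 0 D j.+1.
pose m := (vc w + vc w') / 2.
have ww' : vc w < vc w' by exact: vcoord_nth.
have wD : w \in D := mem_nth 0 jD'.
have w'D : w' \in D := mem_nth 0 jD.
(* By the sorting, z lies left of [w] or right of [w']. Chords having slope at most 1, the cones
   over z are no tighter at [m] than those over the neighbour on that side, so [w] and [w']
   determine both envelopes there. *)
have cone z : z \in D ->
    Num.min (qc w) (qc w') + (vc w' - vc w) / 2 <= qc z + `|m - vc z| /\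
    qc z - `|m - vc z| <= Num.max (qc w) (qc w') - (vc w' - vc w) / 2.
  move=> zD; have := sample_cone D_incomparable zD wD.
  have := sample_cone D_incomparable zD w'D.
  have : vc z <= vc w \/ vc w' <= vc z.
    rewrite -(nth_index 0 zD); have [ij|ji] := leqP (index z D) j.
      by left; exact: vcoord_nth_le.
    by right; apply: vcoord_nth_le; rewrite ?index_mem.
  have /andP[mn1 mn2] : Num.min (qc w) (qc w') <= qc w <= Num.max (qc w) (qc
    w').
    by rewrite ge_min le_max lexx.
  have /andP[mx1 mx2] : Num.min (qc w) (qc w') <= qc w' <= Num.max (qc w) (qc
    w').
    by rewrite ge_min le_max lexx !orbT.
  case=> [zw|wz].
    rewrite (ler0_norm (_ : vc z - vc w <= 0)) ?subr_le0// => _.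
    rewrite (ger0_norm (_ : 0 <= m - vc z)) ?subr_ge0; last by rewrite /m; lra.
    rewrite ler_norml => /andP[? ?]; split.
      by rewrite /m; lra.
    by rewrite /m; lra.
  rewrite (ger0_norm (_ : 0 <= vc z - vc w')) ?subr_ge0// => + _.
  rewrite (ler0_norm (_ : m - vc z <= 0)) ?subr_le0; last by rewrite /m; lra.
  rewrite ler_norml => /andP[? ?]; split.
    by rewrite /m; lra.
  by rewrite /m; lra.
have mD : vsegment delta D m.
  have := vsegment_nth jD; have := vsegment_nth jD'.
  rewrite /vsegment /= !in_itv /= -/w -/w' => /andP[? ?] /andP[? ?].
  by rewrite /m; apply/andP; split; lra.
apply: le_trans (lambda_max_ge delta1_gt0 delta2_gt0 D_incomparable dataset_neq0
  (ltW anchors_lt) mD).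
have [z zD ->] := upper_attained delta dataset_neq0 m.
have [u uD ->] := lower_attained delta dataset_neq0 m.
have [+ _] := cone z zD; have [_ +] := cone u uD.
case: (ltrgtP (qc w) (qc w')) => *; lra.
Qed.

End Gaps.

(** * The ceiling formula *)

Section SampleCount.
Context {R : realType}.
Variable delta : 'cV[R]_2.
Hypotheses (delta1_gt0 : 0 < delta 0 0) (delta2_gt0 : 0 < delta 1 0).
Implicit Types (a : 'cV[R]_2).

(** The argument of the ceiling in [min_samples] is the length of the v-segment in units of 2 sqrt
    2, the widest admissible step. *)
Lemma vcoord_diff (a1 a2 : 'cV[R]_2) :
  vcoord delta a2 - vcoord delta a1 =
  4^-1 * ((a2 0 0 - a1 0 0) / delta 0 0 + (a1 1 0 - a2 1 0) / delta 1 0)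
    * (2 * Num.sqrt 2).
Proof. by rewrite !vcoordE; field; rewrite !gt_eqF. Qed.

(** The ceiling is the least number of such steps covering the segment. A positive length makes it
    positive, so [absz] keeps its value, and [k.+1] steps have [k.+2] ends. *)
Lemma min_samplesP (a1 a2 : 'cV[R]_2) : vcoord delta a1 < vcoord delta a2 ->
  exists2 k, min_samples delta a1 a2 = k.+2 &
    vcoord delta a2 - vcoord delta a1 <= k.+1%:R * (2 * Num.sqrt 2) /\
    forall m, (m < k.+1)%N ->
      m%:R * (2 * Num.sqrt 2) < vcoord delta a2 - vcoord delta a1.
Proof.
rewrite -subr_gt0 /min_samples vcoord_diff; set x := 4^-1 * _.
have s0 : 0 < 2 * Num.sqrt 2 :> R by rewrite mulr_gt0// sqrtr_gt0.
rewrite pmulr_lgt0// => x0.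
have c0 : 0 < Num.ceil x by rewrite ceil_gt0.
case E : (absz (Num.ceil x)) => [|k]; first by move/eqP: E;
  rewrite absz_eq0 gt_eqF.
have Ek : Num.ceil x = k.+1 by rewrite -E gez0_abs// ltW.
exists k => //; split=> [|m mk].
  by rewrite ler_pM2r// [k.+1%:R]pmulrn -Ek ceil_ge.
by rewrite ltr_pM2r// [m%:R]pmulrn -ceil_gt_int Ek.
Qed.

End SampleCount.

(** * Data-sets with prescribed v-coordinates *)

Section Datasets.
Context {R : realType} {n : nat}.
Variable delta : 'cV[R]_2.
Hypotheses (delta1_gt0 : 0 < delta 0 0) (delta2_gt0 : 0 < delta 1 0).
Variables (S : set 'cV[R]_n) (f : 'cV[R]_n -> 'cV[R]_2) (a1 a2 : 'cV[R]_2).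
Implicit Types (z w : 'cV[R]_2) (v q : R) (D : seq 'cV[R]_2) (t : seq R).

Local Notation vc := (vcoord delta).
Local Notation qc := (qcoord delta).
Local Notation PF := (pareto_front S f).

Lemma pareto_pairwise D : (forall z, z \in D -> PF z) ->
  {in D &, forall z w, z != w -> incomparable delta z w}.
Proof.
by move=> DP z w /DP zP /DP wP zw;
  exact: (pareto_incomparable delta1_gt0 delta2_gt0 zw zP wP).
Qed.

(** The front is a graph over v: distinct points with equal v would give |dq| < 0. *)
Lemma pareto_eq z w : PF z -> PF w -> vc z = vc w -> z = w.
Proof.
move=> zP wP e; apply/eqP/negPn/negP => zw.
have := pareto_incomparable delta1_gt0 delta2_gt0 zw zP wP.
by rewrite /incomparable e subrr normr0 ltNge normr_ge0.
Qed.

Lemma sorted_vcoord D : (forall z, z \in D -> PF z) ->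
  sorted (fun z w => z 0 0 < w 0 0) D = sorted (fun z w => vc z < vc w) D.
Proof.
move=> DP; have := pareto_pairwise DP => I.
have {}I : {in D &, forall z w, (z 0 0 < w 0 0) = (vc z < vc w)}.
  move=> z w zD wD; have [->|zw] := eqVneq z w; first by rewrite !ltxx.
  exact: (incomparable_lt1 delta1_gt0 delta2_gt0 (I _ _ zD wD zw)).
by apply: (@eq_in_sorted _ (mem D)) => //; exact/allP.
Qed.

Lemma dataset_facts D : is_dataset S f a1 a2 D ->
  [/\ {in D &, forall z w, z != w -> incomparable delta z w},
      sorted (fun z w => vc z < vc w) D, (1 < size D)%N,
      anchor1 D = a1 & anchor2 D = a2].
Proof.
move=> [_ _ [s eD] sD DP]; split.
- exact: pareto_pairwise.
- by rewrite -sorted_vcoord.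
- by rewrite eD /= size_rcons.
- by rewrite eD.
- by rewrite eD /anchor2 /= last_rcons.
Qed.

Lemma vcoord_continuous : continuous (vc : 'cV[R]_2 -> R).
Proof.
have cst_c (x : R) : continuous (cst x : 'cV[R]_2 ->
  R) by exact: cst_continuous.
have -> : (vc : 'cV[R]_2 -> R) = cst (Num.sqrt 2 / 2) \*
    ((fun z : 'cV[R]_2 => z 0 0) \* cst (delta 0 0)^-1
     \- (fun z : 'cV[R]_2 => z 1 0) \* cst (delta 1 0)^-1).
  by apply/funext => z; rewrite vcoordE.
move=> z; apply: (@continuousM R); first exact: cst_c.
by apply: (@continuousB R); (apply: (@continuousM R);
  [exact: coord_continuous|exact: cst_c]).
Qed.

Hypothesis PF_curve : compact_curve PF.
Hypotheses (a1_anchor : is_anchor 0 S f a1) (a2_anchor : is_anchor 1 S f a2).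
Hypothesis a12 : vc a1 < vc a2.

(** Intermediate value theorem for v along the parametrized front. The parametrization may meet the
    anchors in either order, hence two cases. *)
Lemma pareto_ivt v : vc a1 <= v <= vc a2 -> exists2 z, PF z & vc z = v.
Proof.
case: PF_curve => g gc PFE; case: a1_anchor => + _; case: a2_anchor => + _.
rewrite PFE => -[s2 s2I <-] [s1 s1I <-].
have gc' : {within `[0, 1], continuous (vc \o g)}.
  by apply: within_continuous_comp gc => z _; exact: vcoord_continuous.
move: s1I s2I; rewrite /= !in_itv /= => /andP[s10 s11] /andP[s20 s21] vI.
have sub a b : 0 <= a -> b <= 1 -> `[a, b] `<=` `[0, 1 : R].
  by move=> a0 b1; apply: subset_itv; rewrite bnd_simp.
have [s12|/ltW s12] := leP s1 s2.
  have [||s sI sv] := @IVT R (vc \o g) s1 s2 v s12.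
  - by apply: continuous_subspaceW gc'; exact: sub.
  - move: vI => /andP[v1 v2] /=; rewrite ge_min le_max v1 v2 orbT//.
  - by exists (g s) => //; exists s => //; apply: (sub _ _ s10 s21).
have [||s sI sv] := @IVT R (vc \o g) s2 s1 v s12.
- by apply: continuous_subspaceW gc'; exact: sub.
- by move: vI => /andP[v1 v2] /=; rewrite ge_min le_max v1 v2 orbT.
- by exists (g s) => //; exists s => //; apply: (sub _ _ s20 s11).
Qed.

(** Each entry of [t] lifts to the front by [pareto_ivt]; the end points of the lift are the anchors
    because the front is a graph over v. *)
Lemma dataset_exists t : (1 < size t)%N -> sorted <%R t ->
  head 0 t = vc a1 -> last 0 t = vc a2 ->
  exists2 D, is_dataset S f a1 a2 D & map vc D = t.
Proof.
move=> t_gt1 t_sorted t_head t_last.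
have tI : {in t, forall v, vc a1 <= v <= vc a2}.
  move=> v vt; rewrite -t_head -t_last.
  have st : sorted <=%R t by apply: sub_sorted t_sorted => x y /ltW.
  have nth_le := sorted_leq_nth le_trans lexx 0 st.
  have t_gt0 := ltnW t_gt1; have vi : (index v t < size t)%N by rewrite
    index_mem.
  rewrite -(nth_index 0 vt) -nth0 -nth_last !nth_le ?inE ?ltn_predL//.
  by rewrite -ltnS prednK.
have [D [DP Dt]] : exists D, (forall z, z \in D -> PF z) /\ map vc D = t.
  elim: t tI {t_gt1 t_sorted t_head t_last} => [|v t IH] tI;
    first by exists [::].
  have [|z zP <-] := pareto_ivt (v := v); first by apply: tI; rewrite mem_head.
  have [|D [DP <-]] := IH; first by move=> w wt; apply: tI; rewrite inE wt orbT.
  exists (z :: D); split=> // w; rewrite inE => /predU1P[->//|]; exact: DP.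
exists D => //; split=> //.
- case: D DP Dt => [|z D] DP Dt; first by move: t_gt1; rewrite -Dt.
  case/lastP: D => [|D w] in DP Dt *; first by move: t_gt1; rewrite -Dt.
  exists D; congr cons; last congr rcons.
    apply: pareto_eq; [exact/DP/mem_head|exact: a1_anchor.1|].
    by rewrite -t_head -Dt.
  apply: pareto_eq; [|exact: a2_anchor.1|].
    by apply: DP; rewrite inE mem_rcons mem_head orbT.
  by rewrite -t_last -Dt /= last_map last_rcons.
- by move: t_sorted; rewrite sorted_vcoord// -Dt sorted_map.
Qed.

Lemma even_dataset k : exists2 D, is_dataset S f a1 a2 D &
  size D = k.+2 /\ evenly_allocated delta D.
Proof.
pose p (j : nat) := vc a1 + j%:R / k.+1%:R * (vc a2 - vc a1).
have [||||D DD Dt] := @dataset_exists (mkseq p k.+2).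
- by rewrite size_mkseq.
- apply: (homo_sorted (e := ltn)); last exact: iota_ltn_sorted.
  by move=> i j ij; rewrite /p ltrD2l ltr_pM2r ?subr_gt0// ltr_pM2r
    ?invr_gt0// ltr_nat.
- by rewrite /= /p mul0r mul0r addr0.
- rewrite -nth_last size_mkseq nth_mkseq//= /p divff ?pnatr_eq0//.
  by rewrite mul1r addrC subrK.
exists D => //; have sD : size D = k.+2 by rewrite -(size_map vc) Dt size_mkseq.
have [_ _ _ e1 e2] := dataset_facts DD; split=> // j jD; rewrite e1 e2.
by rewrite -(nth_map _ 0)// Dt; rewrite sD in jD *; rewrite nth_mkseq.
Qed.

End Datasets.

(** * Problems whose front is a given graph *)

Section GraphFront.
Context {R : realType} {n : nat}.
Variable delta : 'cV[R]_2.
Hypotheses (delta1_gt0 : 0 < delta 0 0) (delta2_gt0 : 0 < delta 1 0).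
Variables (i : 'I_n) (v1 v2 : R) (g : R -> R).
Hypothesis v12 : v1 < v2.
Hypothesis g_contract : forall v w, v != w -> `|g v - g w| < `|v - w|.
Implicit Types (z : 'cV[R]_2) (v w q : R).

Local Notation vc := (vcoord delta).
Local Notation qc := (qcoord delta).

(** The objective depends on the single entry [x i 0], so one construction serves every dimension
    that has an index [i]. *)
Let S : set 'cV[R]_n := [set x | v1 <= x i 0 <= v2].
Let p v := vq_point delta v (g v).
Let f (x : 'cV[R]_n) := p (x i 0).

Lemma graph_image : f @` S = [set p v | v in `[v1, v2]].
Proof.
apply/seteqP; split=> [_ [x xS <-]|_ [v vI <-]].
  by exists (x i 0) => //=; rewrite in_itv.
exists (const_mx v); last by rewrite /f mxE.
by move: vI; rewrite /S /= mxE in_itv.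
Qed.

Lemma graph_incomparable v w : v != w -> incomparable delta (p v) (p w).
Proof.
by move=> vw; rewrite /incomparable !vcoord_point// !qcoord_point//;
  exact: g_contract.
Qed.

(** Strict nonexpansiveness makes the points of the graph pairwise incomparable, so the whole image
    is non-dominated. *)
Lemma graph_front : pareto_front S f = [set p v | v in `[v1, v2]].
Proof.
rewrite /pareto_front graph_image; apply/seteqP; split=> [z []//|_ [v vI <-]].
split; first by exists v.
move=> _ [w wI <-] dom.
have [vw|vw] := eqVneq w v.
  by move: dom; rewrite vw => /(dominatesE delta1_gt0 delta2_gt0)[];
    rewrite eqxx.
have I := graph_incomparable vw.
by case: ((incomparableP delta1_gt0 delta2_gt0 (incomparable_neq I)).1 I) =>
  /(_ dom).
Qed.

Lemma graph_curve : compact_curve (pareto_front S f).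
Proof.
have gc : continuous g.
  apply: nonexpansive_continuous => v w; have [->|vw] := eqVneq v w.
    by rewrite subrr normr0 addr0.
  have := g_contract vw; rewrite ltr_norml => /andP[_]; lra.
pose u s := v1 + s * (v2 - v1).
pose e (k : 'I_2) : 'cV[R]_2 := invmx (Wmx delta) *m delta_mx k 0.
(* Decomposition along the columns of the inverse of W, which reduces continuity of [p] to that of
   [g]. *)
have pE : p = (fun v => v *: e 0 + g v *: e 1).
  apply/funext => v; rewrite /p /vq_point /e !scalemxAr -mulmxDr;
    congr (_ *m _).
  apply/colP => k; rewrite !mxE /=.
  by case: k => -[|[|//]] ?; rewrite /= ?mulr1 ?mulr0 ?addr0 ?add0r.
have pc : continuous p.
  rewrite pE => v; apply: cvgD; apply: cvgZr_tmp; first exact: cvg_id.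
  exact: gc.
have uc : continuous u.
  move=> s; apply: cvgD; first exact: cvg_cst.
  by apply: cvgM; [exact: cvg_id|exact: cvg_cst].
exists (p \o u).
  by apply: continuous_subspaceT => s; apply: continuous_comp;
    [exact: uc|exact: pc].
have d0 : 0 < v2 - v1 by rewrite subr_gt0.
rewrite graph_front; apply/seteqP; split=> [_ [v vI <-]|_ [s sI <-]].
  exists ((v - v1) / (v2 - v1));
    last by rewrite /= /u divfK ?gt_eqF// addrC subrK.
  move: vI; rewrite /= !in_itv /= => /andP[h1 h2].
  by rewrite divr_ge0 ?(ltW d0) ?subr_ge0//= ler_pdivrMr// mul1r lerB.
exists (u s) => //; move: sI; rewrite /= !in_itv /= /u => /andP[h1 h2].
by apply/andP; split; nra.
Qed.

Lemma graph_anchor1 : is_anchor 0 S f (p v1).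
Proof.
rewrite /is_anchor graph_front; split.
  by exists v1 => //=; rewrite in_itv /= lexx ltW.
move=> x; rewrite /S /f /= => /andP[h _]; have [->//|xv] := eqVneq (x i 0) v1.
rewrite leNgt (incomparable_lt1 delta1_gt0 delta2_gt0 (graph_incomparable xv)).
by rewrite !vcoord_point// -leNgt.
Qed.

Lemma graph_anchor2 : is_anchor 1 S f (p v2).
Proof.
rewrite /is_anchor graph_front; split.
  by exists v2 => //=; rewrite in_itv /= lexx ltW.
move=> x; rewrite /S /f /= => /andP[_ h]; have [->//|xv] := eqVneq (x i 0) v2.
rewrite leNgt (incomparable_lt2 delta1_gt0 delta2_gt0 (graph_incomparable xv)).
by rewrite !vcoord_point// -leNgt.
Qed.

Lemma graph_front_exists :
  exists (S : set 'cV[R]_n) (f : 'cV[R]_n -> 'cV[R]_2),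
    [/\ compact_curve (pareto_front S f),
        is_anchor 0 S f (vq_point delta v1 (g v1)),
        is_anchor 1 S f (vq_point delta v2 (g v2)) &
        forall z, pareto_front S f z -> qc z = g (vc z)].
Proof.
exists S, f; split; [exact: graph_curve|exact: graph_anchor1|exact:
  graph_anchor2|].
by rewrite graph_front => _ [v _ <-]; rewrite qcoord_point// vcoord_point.
Qed.

End GraphFront.

(** * Strictly nonexpansive functions with a flatter stretch *)

Lemma clamp_nonexpansive (R : realDomainType) (x y : R) : x <= y ->
  0 <= Num.min 1 (Num.max 0 y) - Num.min 1 (Num.max 0 x) <= y - x.
Proof.
have m0 : Num.min 1 0 = 0 :> R by rewrite min_r.
case: (leP 0 x) => ?; case: (leP 0 y) => ?; rewrite ?m0;
  case: (leP 1 x) => ?; case: (leP 1 y) => ?; lra.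
Qed.

(* Slope [tau] outside [[w, w']] and a slope reduced by the factor
   [(w' - w - c) / (w' - w)] inside. *)
Lemma bent_line (R : realFieldType) (v1 v2 q1 q2 w w' c : R) :
  0 < c -> v1 <= w -> w' <= v2 -> c < w' - w -> `|q2 - q1| < v2 - v1 - c ->
  exists g : R -> R, [/\ g v1 = q1, g v2 = q2,
    forall x y, x != y -> `|g x - g y| < `|x - y| &
    c < w' - w - `|g w' - g w|].
Proof.
move=> c0 vw wv cw qq.
pose clamp x : R := Num.min 1 (Num.max 0 x).
pose d := w' - w.
have d0 : 0 < d by rewrite /d; lra.
have l0 : 0 < v2 - v1 - c by rewrite /d in d0; lra.
(* The total increase of [phi] below is [v2 - v1 - c], so this slope fits both end values. *)
pose tau := (q2 - q1) / (v2 - v1 - c).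
have tau1 : `|tau| < 1.
  by rewrite normrM normfV (gtr0_norm l0) ltr_pdivrMr// mul1r.
(* Grows at rate 1 outside [[w, w']] and at rate [1 - c / d] inside, so that crossing the step loses
   exactly [c]. *)
pose phi v := v - v1 - c * clamp ((v - w) / d).
have clamp0 x : x <= 0 -> clamp x = 0.
  by move=> x0; rewrite /clamp (max_idPl x0) min_r.
have clamp1 x : 1 <= x -> clamp x = 1.
  by move=> x1; rewrite /clamp max_r ?min_l//; lra.
have clampD x y : x <= y -> 0 <= clamp y - clamp x <= y - x.
  exact: clamp_nonexpansive.
have phi_homo x y : x <= y -> 0 <= phi y - phi x <= y - x.
  move=> xy; have xy' : (x - w) / d <= (y - w) / d.
    by rewrite ler_pM2r ?invr_gt0// lerB.
  have /andP[h1 h2] := clampD _ _ xy'.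
  have h3 : d * ((y - w) / d - (x - w) / d) = y - x.
    by field; rewrite gt_eqF.
  rewrite /phi; set a := clamp ((y - w) / d) in h1 h2 *;
    set b := clamp ((x - w) / d) in h1 h2 *.
  have h4 : d * (a - b) <= y - x by rewrite -h3 ler_pM2l.
  by apply/andP; split; rewrite /d in h4 d0; nra.
pose g v := q1 + tau * phi v.
have gB x y : g x - g y = tau * (phi x - phi y) by rewrite /g; ring.
have phiw : phi w' - phi w = d - c.
  by rewrite /phi subrr mul0r (clamp0 0)// -/d divff ?gt_eqF// clamp1// /d;
    ring.
exists g; split.
- rewrite /g /phi clamp0; first by ring.
  by rewrite mulr_le0_ge0 ?invr_ge0 ?(ltW d0)// subr_le0.
- rewrite /g /phi clamp1; last by rewrite ler_pdivlMr// mul1r /d; lra.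
  by rewrite mulr1 divfK ?gt_eqF//; ring.
- have lt x y : x < y -> `|g x - g y| < `|x - y|.
    move=> xy; have /andP[h1 h2] := phi_homo _ _ (ltW xy).
    rewrite gB normrM (ler0_norm (_ : phi x - phi y <= 0)); last lra.
    rewrite (ler0_norm (_ : x - y <= 0)); last lra.
    have h0 : 0 <= `|tau| by [].
    (* Only weak monotonicity of [phi] is at hand: strictness comes from [x < y] if the increment is
       0, and from [|tau| < 1] otherwise. *)
    have [e|ne] := eqVneq (phi y - phi x) 0; first by rewrite opprB e; lra.
    nra.
  move=> x y; rewrite neq_lt => /orP[xy|xy]; first exact: lt.
  by rewrite distrC (distrC x); exact: lt.
- have dc : 0 < d - c by rewrite /d; lra.
  rewrite gB phiw normrM (gtr0_norm dc) -/d.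
  have : `|tau| * (d - c) < 1 * (d - c) by rewrite ltr_pM2r.
  lra.
Qed.

(** * The minimum number of samples *)

Section Counting.
Context {R : realType} {n : nat}.
Variable delta : 'cV[R]_2.
Hypotheses (delta1_gt0 : 0 < delta 0 0) (delta2_gt0 : 0 < delta 1 0).
Implicit Types (S : set 'cV[R]_n) (f : 'cV[R]_n -> 'cV[R]_2).

Local Notation vc := (vcoord delta).
Local Notation qc := (qcoord delta).

Lemma dataset_anchors_lt S f a1 a2 D :
  is_dataset S f a1 a2 D -> vc a1 < vc a2.
Proof.
move=> DD; have [_ sD D1 <- <-] := dataset_facts delta1_gt0 delta2_gt0 DD.
exact: anchors_lt.
Qed.

(** In dimension 0 the decision space is one point and the anchors would coincide. This supplies the
    index on which the example fronts depend. *)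
Lemma dataset_dim_gt0 S f a1 a2 D : is_dataset S f a1 a2 D -> (0 < n)%N.
Proof.
move=> DD; have := dataset_anchors_lt DD.
case: DD => -[[[x _ <-] _] _] [[[y _ <-] _] _] _ _ _.
rewrite lt0n; apply: contraTneq => n0.
have -> : x = y; last by rewrite ltxx.
have nF : (0 < n)%N = false by rewrite n0.
by apply/colP => i; have := leq_ltn_trans (leq0n i) (ltn_ord i); rewrite nF.
Qed.

Lemma even_lambda_max S f a1 a2 E : is_dataset S f a1 a2 E ->
  size E = min_samples delta a1 a2 -> evenly_allocated delta E ->
  lambda_max delta E <= 2 * Num.sqrt 2.
Proof.
move=> DE sE even; have := dataset_anchors_lt DE.
have [IE soE E1 e1 e2] := dataset_facts delta1_gt0 delta2_gt0 DE.
move=> /(min_samplesP delta1_gt0 delta2_gt0)[k kE [le_k _]].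
apply: lambda_max_le => // j jE.
rewrite (even j.+1 jE) (even j (ltnW jE)) sE kE /= e1 e2.
set d := vc a2 - vc a1 in le_k *.
have -> : vc a1 + j.+1%:R / k.+1%:R * d - (vc a1 + j%:R / k.+1%:R * d) =
    d / k.+1%:R.
  rewrite opprD addrACA subrr add0r -!mulrBl -[j.+1%:R]natr1 addrAC subrr add0r.
  by rewrite mul1r mulrC.
by rewrite ler_pdivrMr ?ltr0n// mulrC.
Qed.

Lemma min_samples_attained S f a1 a2 D : is_dataset S f a1 a2 D ->
  surely_attained delta n (vc a1) (vc a2) (min_samples delta a1 a2).
Proof.
move=> DD S' f' b1 b2 PF' b1A b2A e1 e2.
have a12 := dataset_anchors_lt DD.
have b12 : vc b1 < vc b2 by rewrite e1 e2.
(* The anchors of the two fronts share only their v-coordinates, but these fix the argument of the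
   ceiling. *)
have M_eq : min_samples delta b1 b2 = min_samples delta a1 a2.
  rewrite /min_samples; congr (absz (Num.ceil _)).+1.
  have s0 : 2 * Num.sqrt 2 != 0 :> R by rewrite gt_eqF// mulr_gt0// sqrtr_gt0.
  by apply: (mulIf s0); rewrite -!vcoord_diff// e1 e2.
have [k kE _] := min_samplesP delta1_gt0 delta2_gt0 b12.
have [E DE [sE even]] := even_dataset delta1_gt0 delta2_gt0 PF' b1A b2A b12 k.
exists E; split=> //; first by rewrite sE -kE.
by apply: even_lambda_max DE _ even; rewrite sE kE.
Qed.

Lemma min_samples_minimal S f a1 a2 D M : is_dataset S f a1 a2 D ->
  surely_attained delta n (vc a1) (vc a2) M -> (min_samples delta a1 a2 <= M)%N.
Proof.
move=> DD surely; have a12 := dataset_anchors_lt DD.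
have [k -> [_ lt_k]] := min_samplesP delta1_gt0 delta2_gt0 a12.
rewrite leqNgt; apply/negP => Mk.
pose i := Ordinal (dataset_dim_gt0 DD).
(* On a flat front the term |dq| of [lambda_max_ge_gap] vanishes, so one step wider than 2 sqrt 2
   violates the bound. Only the v-coordinates of the anchors are prescribed, so this front is
   admissible. *)
pose g : R -> R := fun=> 0.
have gL v w : v != w -> `|g v - g w| < `|v - w|.
  by move=> vw; rewrite subrr normr0 normr_gt0 subr_eq0.
have [S' [f' [PF' A1 A2 q0]]] :=
  graph_front_exists delta1_gt0 delta2_gt0 i a12 gL.
have [||E [DE sE]] := surely S' f' _ _ PF' A1 A2; rewrite ?vcoord_point//.
have [IE soE E1 e1 e2] := dataset_facts delta1_gt0 delta2_gt0 DE.
have [_ _ _ _ EP] := DE.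
have [||j] := @wide_step R 0 (2 * Num.sqrt 2) (map vc E);
  first by rewrite size_map.
  rewrite -nth_last -nth0 size_map !(nth_map 0) ?ltn_predL ?(ltnW E1)//.
  rewrite -anchor1_nth -anchor2_nth e1 e2 !vcoord_point// sE; apply: lt_k.
  (* [M] samples make [M - 1] steps, fewer than [k.+1]. *)
  by move: Mk E1; rewrite sE; case: (M).
rewrite size_map => jE; rewrite !(nth_map 0) ?(ltnW jE)//.
move=> wide; have := lambda_max_ge_gap delta1_gt0 delta2_gt0 IE soE E1 jE.
rewrite !q0 /g; [|exact/EP/mem_nth/ltnW|exact/EP/mem_nth].
by rewrite subrr normr0 subr0; lra.
Qed.

(** With x and y the scaled extents of the anchors in the two objectives, dv - |dq| = sqrt 2 *
    min(x, y), and both extents exceed 2. This is the slack that [bent_line] requires. *)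
Lemma qcoord_diff_lt (a1 a2 : 'cV[R]_2) :
  2 * delta 0 0 < a2 0 0 - a1 0 0 -> 2 * delta 1 0 < a1 1 0 - a2 1 0 ->
  `|qc a2 - qc a1| < vc a2 - vc a1 - 2 * Num.sqrt 2.
Proof.
move=> h1 h2; rewrite !vcoordE !qcoordE.
have /= {}h1 : 2 < (a2 0 0 - a1 0 0) / delta 0 0 by rewrite ltr_pdivlMr.
have /= {}h2 : 2 < (a1 1 0 - a2 1 0) / delta 1 0 by rewrite ltr_pdivlMr.
have s0 : 0 < Num.sqrt 2 :> R by rewrite sqrtr_gt0.
rewrite mulrBl in h1; rewrite mulrBl in h2.
move: (a1 0 0 / _) (a2 0 0 / _) (a1 1 0 / _) (a2 1 0 / _) (Num.sqrt 2) h1 h2 s0.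
move=> x1 x2 y1 y2 s h1 h2 s0.
by rewrite ltr_norml; apply/andP; split; nra.
Qed.

(** Prescribed anchors may exclude a flat front. Instead, pigeonhole finds a wide step in [t], and
    [bent_line] joins the anchors by a graph flat enough over that step to keep dv - |dq| above 2
    sqrt 2. *)
Lemma too_few_samples S f a1 a2 D (t : seq R) : is_dataset S f a1 a2 D ->
  2 * delta 0 0 < a2 0 0 - a1 0 0 -> 2 * delta 1 0 < a1 1 0 - a2 1 0 ->
  (size t < min_samples delta a1 a2)%N -> sorted <%R t ->
  head 0 t = vc a1 -> last 0 t = vc a2 ->
  exists (S' : set 'cV[R]_n) (f' : 'cV[R]_n -> 'cV[R]_2) (E : seq 'cV[R]_2),
    [/\ compact_curve (pareto_front S' f'), is_dataset S' f' a1 a2 E,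
        [seq vc z | z <- E] = t & 2 * Num.sqrt 2 < lambda_max delta E].
Proof.
move=> DD h1 h2 t_lt t_sorted t1 t2; have a12 := dataset_anchors_lt DD.
have [k kE [_ lt_k]] := min_samplesP delta1_gt0 delta2_gt0 a12.
have t_gt1 : (1 < size t)%N.
  by move: a12; rewrite -t1 -t2;
    case: t {t_lt t_sorted t1 t2} => [|x [|]] //=; rewrite ltxx.
have c0 : 0 < 2 * Num.sqrt 2 :> R by rewrite mulr_gt0// sqrtr_gt0.
have [|j jt wide] := @wide_step R 0 (2 * Num.sqrt 2) t t_gt1.
  rewrite t1 t2; apply: lt_k; rewrite kE in t_lt.
  by move: t_lt t_gt1; case: (size t).
have nth_le := sorted_leq_nth le_trans lexx 0 (sub_sorted (@ltW _ _) t_sorted).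
have t_gt0 := ltnW t_gt1; have jt' := ltnW jt.
have [||g [g1 g2 gL gap]] := bent_line c0 _ _ wide (qcoord_diff_lt h1 h2).
- by rewrite -t1 -nth0 nth_le ?inE.
- by rewrite -t2 -nth_last nth_le ?inE ?ltn_predL// -ltnS prednK.
have [S' [f' [PF' A1 A2 qg]]] := graph_front_exists delta1_gt0 delta2_gt0
  (Ordinal (dataset_dim_gt0 DD)) a12 gL.
rewrite g1 vq_point_coord// in A1; rewrite g2 vq_point_coord// in A2.
have [E DE Et] := dataset_exists delta1_gt0 delta2_gt0 PF' A1 A2 t_gt1
  t_sorted t1 t2.
exists S', f', E; split=> //.
have [IE soE E1 e1 e2] := dataset_facts delta1_gt0 delta2_gt0 DE.
have [_ _ _ _ EP] := DE.
have sE : size E = size t by rewrite -Et size_map.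
rewrite -sE in jt jt'.
apply: lt_le_trans (lambda_max_ge_gap delta1_gt0 delta2_gt0 IE soE E1 jt).
have vE i : (i < size E)%N -> vc (nth 0 E i) = nth 0 t i.
  by move=> iE; rewrite -Et (nth_map 0).
by rewrite !qg ?vE//; apply/EP/mem_nth.
Qed.

End Counting.

Theorem proposition3 (R : realType) (n : nat)
    (S : set 'cV[R]_n) (f : 'cV[R]_n -> 'cV[R]_2) (delta : 'cV[R]_2)
    (delta1_gt0 : 0 < delta 0 0) (delta2_gt0 : 0 < delta 1 0)
    (PF_curve : compact_curve (pareto_front S f))
    (a1 a2 : 'cV[R]_2) (D : seq 'cV[R]_2)
    (dataD : is_dataset S f a1 a2 D) :
  [/\ (* lambda_max is a maximum *)
      exists2 v, vsegment delta D v & h_gap delta D v = lambda_max delta D,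
      (* (i) <-> (ii) *)
      (forall h, FPFS delta D h ->
         realizable_within_tolerance delta
           (curve delta D (h_central delta D)) (curve delta D h))
      <-> lambda_max delta D <= 2 * Num.sqrt 2,
      (* the minimum number of samples, over all shapes on the v-segment *)
      surely_attained delta n (vcoord delta a1) (vcoord delta a2)
        (min_samples delta a1 a2)
      /\ (forall M,
            surely_attained delta n (vcoord delta a1) (vcoord delta a2) M ->
            (min_samples delta a1 a2 <= M)%N),
      (* even allocation of that number of samples exists and attains (ii) *)
      (exists2 E, is_dataset S f a1 a2 E &
         size E = min_samples delta a1 a2 /\ evenly_allocated delta E)
      /\ (forall E, is_dataset S f a1 a2 E ->
            size E = min_samples delta a1 a2 -> evenly_allocated delta E ->
            lambda_max delta E <= 2 * Num.sqrt 2) &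
      (* with both anchors prescribed: no placement of fewer v-coordinates
         attains (ii) for all shapes *)
      2 * delta 0 0 < a2 0 0 - a1 0 0 -> 2 * delta 1 0 < a1 1 0 - a2 1 0 ->
      forall t : seq R,
        (size t < min_samples delta a1 a2)%N -> sorted <%R t ->
        head 0 t = vcoord delta a1 -> last 0 t = vcoord delta a2 ->
        exists (S' : set 'cV[R]_n) (f' : 'cV[R]_n -> 'cV[R]_2)
               (E : seq 'cV[R]_2),
          [/\ compact_curve (pareto_front S' f'), is_dataset S' f' a1 a2 E,
              [seq vcoord delta z | z <- E] = t &
              2 * Num.sqrt 2 < lambda_max delta E]].
Proof.
have a12 := dataset_anchors_lt delta1_gt0 delta2_gt0 dataD.
have [D_inc D_sorted D_size _ _] := dataset_facts delta1_gt0 delta2_gt0 dataD.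
have D_neq0 := dataset_neq0 D_size.
have D_segment := ltW (anchors_lt D_sorted D_size).
have [A1 A2 _ _ _] := dataD.
split.
- exact: lambda_max_attained.
- split=> [|lam]; first exact: realizable_lambda_max.
  exact: lambda_max_realizable.
- split=> [|M]; first exact: min_samples_attained dataD.
  exact: min_samples_minimal dataD.
- split=> [|E]; last exact: even_lambda_max.
  have [k -> _] := min_samplesP delta1_gt0 delta2_gt0 a12.
  exact: even_dataset.
- by move=> h1 h2 t; exact: too_few_samples dataD h1 h2.
Qed.
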